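(* Let $2 \leq d \leq n$ be integers. Then $$\frac{2n(n-1)}{d^2} \leq \beta^d(n) \leq \binom{\lceil\frac{2(n-1)}{d-1} \rceil}{2}+\left\lceil\frac{n-1}{d-1}\right\rceil (d+1).$$ Moreover, $\beta^d(n) \geq n-1$ when $d$ is odd.
   Context: Two vectors $A,B\in\mathbb{R}^n$ are trivially orthogonal if for every coordinate $i\in[n]$ at least one of $A(i)$, $B(i)$ is zero; they are non-trivially orthogonal if they are orthogonal (inner product $0$) but not trivially orthogonal. For $2\le d\le n$, the trivial points of the Hamming cube $\{0,1\}^n$ are the all-zero vector and the $n$ unit vectors, together with the all-ones vector when $d$ is odd. $\beta^d(n)$ is the minimum cardinality of a set $\mathcal{V}$ of vectors in $\{-1,0,1\}^n$, each having exactly $d$ non-zero entries, such that every non-trivial point $A\in\{0,1\}^n$ has some $V\in\mathcal{V}$ non-trivially orthogonal to $A$.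
   Formalization: For d = n ≥ 4 no such set of vectors exists (a ±1 vector has odd inner product with a weight-3 point), so β^d(n) is undefined there; the bounds are proved whenever the minimum exists, and it is proved to exist for d < n and for d = n ∈ {2,3}. *)

(* Defs.v *)
From mathcomp Require Export all_boot all_order all_algebra.
From mathcomp Require Export finmap.

Set Implicit Arguments.
Unset Strict Implicit.
Unset Printing Implicit Defensive.

Import GRing.Theory Num.Theory.
Local Open Scope ring_scope.

Definition inner (R : comNzRingType) (n : nat) (A B : 'rV[R]_n) : R :=
  \sum_(i < n) A 0 i * B 0 i.

Definition trivially_orthogonal (R : comNzRingType) (n : nat)
    (A B : 'rV[R]_n) : Prop :=
  forall i : 'I_n, A 0 i = 0 \/ B 0 i = 0.

Definition nontrivially_orthogonal (R : comNzRingType) (n : nat)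
    (A B : 'rV[R]_n) : Prop :=
  inner A B = 0 /\ ~ trivially_orthogonal A B.

Definition cube_point (n : nat) (A : 'rV[int]_n) : Prop :=
  forall i : 'I_n, A 0 i = 0 \/ A 0 i = 1.

Definition trivial_point (d n : nat) (A : 'rV[int]_n) : Prop :=
  [\/ A = 0,
      exists i : 'I_n, A = delta_mx 0 i
    | odd d /\ A = const_mx 1].

Definition signed_vector (d n : nat) (v : 'rV[int]_n) : Prop :=
  (forall i : 'I_n, [\/ v 0 i = -1, v 0 i = 0 | v 0 i = 1]) /\
  #|[set i : 'I_n | v 0 i != 0]| = d.

Definition orthogonal_cover (d n : nat) (V : {fset 'rV[int]_n}) : Prop :=
  (forall v, v \in V -> signed_vector d v) /\
  (forall A : 'rV[int]_n, cube_point A -> ~ trivial_point d A ->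
     exists2 v, v \in V & nontrivially_orthogonal v A).

(* The minimum is a relation because it does not exist for all 2 <= d <= n:
   see [no_beta_full]. *)
Definition is_beta (d n b : nat) : Prop :=
  (exists2 V : {fset 'rV[int]_n}, orthogonal_cover d V & #|` V|%fset = b) /\
  (forall V : {fset 'rV[int]_n}, orthogonal_cover d V -> (b <= #|` V|%fset)%N).

Definition ceil_div (m k : nat) : nat :=
  `|Num.ceil (m%:R / k%:R : rat)|%N.

(* A vector with no zero entry has odd inner product with a point of
   weight 3, and such a point is non-trivial once n > 3. *)
Lemma no_beta_full (n b : nat) : (3 < n)%N -> ~ is_beta n n b.
Proof.
move=> n3 [[V [VS VC] _] _].
pose A : 'rV[int]_n := \row_(i < n) ((i < 3)%N%:R).
have A01 : cube_point A by move=> i; rewrite mxE; case: (_ < _)%N; auto.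
have n0 : (0 < n)%N by apply: ltn_trans n3.
have n1 : (1 < n)%N by apply: ltn_trans n3.
have n2 : (2 < n)%N by apply: ltn_trans n3.
have AN : ~ trivial_point n A.
  case=> [/matrixP H|[i /matrixP H]|[_ /matrixP H]].
  - by have := H 0 (Ordinal n0); rewrite !mxE.
  - have := H 0 (Ordinal n0); have := H 0 (Ordinal n1); rewrite !mxE /=.
    by case: i {H} => [[|[|i]]] //=.
  - by have := H 0 (Ordinal n3); rewrite !mxE.
have [v vV [/eqP + _]] := VC A A01 AN.
have [v1 vn] := VS v vV.
have vnz i : v 0 i != 0.
  have/setP/(_ i) : [set i : 'I_n | v 0 i != 0] = [set: 'I_n].
    by apply/eqP; rewrite eqEcard subsetT cardsT card_ord vn leqnn.
  by rewrite !inE.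
pose a (i : 'I_n) := v 0 i.
have a1 i : a i = -1 \/ a i = 1.
  by case: (v1 i) (vnz i) => [|->|]; rewrite ?eqxx //; auto.
have -> : inner v A =
    a (Ordinal n0) + (a (Ordinal n1) + a (Ordinal n2)).
  rewrite /inner (bigD1 (Ordinal n0)) //= (bigD1 (Ordinal n1)) //=.
  rewrite (bigD1 (Ordinal n2)) //= big1 ?addr0 ?mxE ?mulr1 //.
  by case=> [[|[|[|i]]] il]; rewrite -!val_eqE //= mxE mulr0.
by case: (a1 (Ordinal n0)) => ->; case: (a1 (Ordinal n1)) => ->;
   case: (a1 (Ordinal n2)) => ->.
Qed.

(* Main.v *)
Require Import Defs.
From mathcomp Require Import zify.
From Stdlib Require Import Classical.

(* Lower bounds. A vector v separates a pair {i, j} exactly when v_i v_j = -1,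
   and summing |v_i v_j| - v_i v_j over all (i, j) gives d^2 - (sum v)^2; this
   counts the points of weight 2. For odd d, if there were fewer than n - 1
   vectors, some nonzero x over F_2 with two zero entries would be orthogonal
   to all of them, and then 1 + x, which is non-trivial, would have odd inner
   product with all of them.

   Upper bound. Cover the coordinates by windows of size d + 1 sharing the
   coordinates 0 and 1. On each window take the d + 1 rotations of the vector
   with one zero, followed by a negative half and a positive half of the cycle.
   By a discrete continuity argument they take care of every point having at
   least two ones on the window, unless d is odd and the window is full. As
   windows share two coordinates, one full window forces all of them to be
   full, and the point is trivial. Otherwise the point has at most one one on
   each window. Cut the windows into blocks of at most d/2 coordinates: two
   ones lie in distinct blocks, and the vector attached to this pair of blocks,
   supported inside the two windows, meets no other one of the point. *)

Set Implicit Arguments.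
Unset Strict Implicit.
Unset Printing Implicit Defensive.

Import Order.TTheory GRing.Theory Num.Theory.
Local Open Scope ring_scope.

(** * Rounding up, and counting ones on arcs of a cyclic word *)

Lemma ceil_div_mul (m k : nat) : (0 < k)%N -> (m <= ceil_div m k * k)%N.
Proof.
move=> k0; rewrite /ceil_div; set x : rat := _ / _.
have k0' : (0 : rat) < k%:R by rewrite ltr0n.
have : x <= `|Num.ceil x|%:~R.
  by apply: le_trans (Num.Theory.ceil_ge x) _; rewrite ler_int ler_norm.
by rewrite ler_pdivrMr // -abszE -pmulrn -natrM ler_nat.
Qed.

(** A cyclic word of length N is encoded as an N-periodic function on [nat], so that arcs need no
    reduction modulo N. *)
Definition arc (a : nat -> bool) (c i : nat) : nat := \sum_(j < c) a (i + j)%N.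

Lemma arcS a c i : (arc a c i.+1 + a i = arc a c i + a (i + c))%N.
Proof.
transitivity (\sum_(j < c.+1) a (i + j))%N; last by rewrite big_ord_recr.
rewrite big_ord_recl addn0 addnC; congr (_ + _)%N.
by apply: eq_bigr => j _; rewrite addSnnS.
Qed.

Lemma arc_full a N i : (forall k, a (k + N)%N = a k) -> arc a N i = arc a N 0.
Proof. by move=> aN; elim: i => // i <-; have := arcS a N i; rewrite aN; lia. Qed.

(** Double counting: for each fixed offset in the arc, the starting points sweep one full cycle. *)
Lemma arc_sum a N c : (forall k, a (k + N)%N = a k) ->
  (\sum_(i < N) arc a c i = c * arc a N 0)%N.
Proof.
move=> aN; rewrite exchange_big /= -[c in RHS]card_ord -sum_nat_const.
apply: eq_bigr => j _; rewrite -(arc_full j aN); apply: eq_bigr => i _.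
by rewrite addnC.
Qed.

(** Stepping forward from i reaches [j + i * N], which is at least i since N > 0; periodicity then
    brings it back to j. *)
Lemma periodic_closed N (P : nat -> Prop) : (0 < N)%N ->
  (forall i, P (i + N)%N <-> P i) -> (forall i, P i -> P i.+1) ->
  forall i j, P i -> P j.
Proof.
move=> N0 PN PS i j Pi.
have PD k : P (i + k)%N by elim: k => [|k IH]; rewrite ?addn0 // addnS; exact: PS.
have PM k : P (j + k * N)%N -> P j.
  by elim: k => [|k IH]; rewrite ?addn0 // mulSn addnCA addnC => /PN /IH.
apply: (PM i); have -> : (j + i * N = i + (j + i * N - i))%N by nia.
exact: PD.
Qed.

Lemma sum_const_le N m (F : nat -> nat) : (forall i, F i <= m)%N ->
  (N * m <= \sum_(i < N) F i)%N -> forall i, (i < N)%N -> F i = m.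
Proof.
move=> Fm le i iN; apply/eqP; rewrite eqn_leq Fm /= leqNgt; apply/negP => lt.
have : (\sum_(j < N) F j < \sum_(j < N) m)%N.
  rewrite (bigD1 (Ordinal iN)) //= [X in (_ < X)%N](bigD1 (Ordinal iN)) //=.
  by rewrite -addSn leq_add // leq_sum.
by rewrite sum_nat_const card_ord; lia.
Qed.

Lemma sum_const_ge N m (F : nat -> nat) : (forall i, m <= F i)%N ->
  (\sum_(i < N) F i <= N * m)%N -> forall i, (i < N)%N -> F i = m.
Proof.
move=> Fm le i iN; apply/eqP; rewrite eqn_leq Fm andbT leqNgt; apply/negP => lt.
have : (\sum_(j < N) m < \sum_(j < N) F j)%N.
  rewrite (bigD1 (Ordinal iN)) //= [X in (_ < X)%N](bigD1 (Ordinal iN)) //=.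
  by rewrite -addSn leq_add // leq_sum.
by rewrite sum_nat_const card_ord; lia.
Qed.

(* Sliding an arc of half the cycle by one step changes its number of ones by
   at most 1. If the conclusion fails, then writing w = 2u or w = 2u + 1 the
   count never crosses the threshold between u and u + 1 in one direction, so
   being periodic it stays on one side of it; but its average is
   w (uphalf N) / N. *)
Lemma cyclic_halving (N : nat) (a : nat -> bool) :
  (forall k, a (k + N)%N = a k) -> (2 <= arc a N 0)%N ->
  (arc a N 0 < N)%N \/ odd N ->
  exists2 i, (i < N)%N & (2 * arc a (uphalf N) i = arc a N 0 + a i)%N.
Proof.
set w := arc a N 0; set c := uphalf N => aN w2 wN.
have wle : (w <= N)%N.
  rewrite -[N in (_ <= N)%N]card_ord -[leqRHS]muln1 -sum_nat_const.
  by apply: leq_sum => i _; apply: leq_b1.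
have N0 : (0 < N)%N by lia.
have cE : (2 * c = N + odd N)%N.
  by rewrite /c uphalf_half mul2n doubleD -[in RHS](odd_double_half N); lia.
have S := arc_sum c aN; rewrite -/w in S.
have SS := arcS a c.
have TN i : arc a c (i + N) = arc a c i.
  by apply: eq_bigr => j _; rewrite addnAC aN.
apply: NNPP => H.
have {}H i : (2 * arc a c i <> w + a i)%N.
  move=> E; apply: H; exists (i %% N)%N; first by rewrite ltn_mod.
  have M k m (F : nat -> nat) : (forall k, F (k + N)%N = F k) -> F (m + k * N)%N = F m.
    by move=> FN; elim: k => [|k IH]; rewrite ?addn0 // mulSn addnCA addnC FN.
  rewrite (divn_eq i N) addnC (M _ _ (arc a c)) // in E.
  by rewrite (M _ _ (fun k => nat_of_bool (a k))) // in E => k; rewrite aN.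
have [u wE] : exists u, w = (2 * u + odd w)%N by exists w./2; lia.
case: (boolP (odd w)) wE => ow wE.
(* A drop from [u.+1] to [u] needs [a i] true, which is what [H] forbids when the count is
   [u.+1]. *)
- have cl i : (u < arc a c i -> u < arc a c i.+1)%N.
    by have := SS i; have := H i; case: (a i); case: (a (i + c)) => /=; lia.
  have {}cl := @periodic_closed N (fun i => u < arc a c i)%N N0 _ cl.
  case: (classic (exists i, u < arc a c i)%N) => [[i0 ui0]|nu].
  + have ge i : (u.+1 <= arc a c i)%N by apply: (cl _ i0) => // k; rewrite TN.
    have ge' : (N * u.+1 <= \sum_(i < N) arc a c i)%N.
      by rewrite -[N in (N * _)%N]card_ord -sum_nat_const; apply: leq_sum => i _.
    (* The average can reach [u.+1] only for N odd and w = N; all counts are then [u.+1], and [H]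
       makes every [a i] false. *)
    have wNE : w = N by case: (odd N) cE S ge' wN => *; nia.
    have eq : (\sum_(i < N) arc a c i <= N * u.+1)%N by rewrite S; case: (odd N) cE wN => *; nia.
    have E := sum_const_ge ge eq.
    have a0 i : (i < N)%N -> a i = false.
      by move=> iN; have := H i; rewrite E //; case: (a i) => //=; lia.
    suff : w = 0%N by lia.
    by rewrite /w /arc big1 // => i _; rewrite add0n a0.
  + have le : (\sum_(i < N) arc a c i <= N * u)%N.
      rewrite -[N in (N * _)%N]card_ord -sum_nat_const; apply: leq_sum => i _.
      by rewrite leqNgt; apply/negP => ?; apply: nu; exists i.
    by nia.
(* Here a rise from [u] to [u.+1] needs [a i] false, which [H] forbids when the count is [u]. *)
- have cl i : (arc a c i <= u -> arc a c i.+1 <= u)%N.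
    by have := SS i; have := H i; case: (a i); case: (a (i + c)) => /=; lia.
  have {}cl := @periodic_closed N (fun i => arc a c i <= u)%N N0 _ cl.
  case: (classic (exists i, arc a c i <= u)%N) => [[i0 ui0]|nu].
  + have le i : (arc a c i <= u)%N by apply: (cl _ i0) => // k; rewrite TN.
    have le' : (\sum_(i < N) arc a c i <= N * u)%N.
      by rewrite -[N in (N * _)%N]card_ord -sum_nat_const; apply: leq_sum => i _.
    (* An average of at most [u] forces N even and all counts equal to [u]; [H] then makes every
       [a i] true, against [wN]. *)
    have eN : odd N = false by case: (odd N) cE => // *; nia.
    have ge : (N * u <= \sum_(i < N) arc a c i)%N by rewrite S; nia.
    have E := sum_const_le le ge.
    have a1 i : (i < N)%N -> a i.
      by move=> iN; have := H i; rewrite E //; case: (a i) => //=; lia.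
    suff : w = N by rewrite eN in wN; lia.
    rewrite /w /arc -[RHS]card_ord -[RHS]muln1 -sum_nat_const.
    by apply: eq_bigr => i _; rewrite add0n a1.
  + have ge : (N * u.+1 <= \sum_(i < N) arc a c i)%N.
      rewrite -[N in (N * _)%N]card_ord -sum_nat_const; apply: leq_sum => i _.
      by rewrite ltnNge; apply/negP => ?; apply: nu; exists i.
    by case: (odd N) cE => *; nia.
Qed.

(** * Cube points as sets of coordinates *)

Definition indicator (n : nat) (B : {set 'I_n}) : 'rV[int]_n :=
  \row_i (i \in B)%:R.

Lemma cube_indicator n (B : {set 'I_n}) : cube_point (indicator B).
Proof. by move=> i; rewrite mxE; case: (_ \in _); [right | left]. Qed.

Lemma inner_indicator n (v : 'rV[int]_n) (B : {set 'I_n}) :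
  inner v (indicator B) = \sum_(i in B) v 0 i.
Proof.
rewrite /inner [RHS]big_mkcond; apply: eq_bigr => i _; rewrite mxE.
by case: (_ \in _); rewrite ?mulr1 ?mulr0.
Qed.

Lemma nontrivial_indicator d n (B : {set 'I_n}) :
  (2 <= #|B|)%N -> ~~ odd d \/ (#|B| < n)%N -> ~ trivial_point d (indicator B).
Proof.
move=> B2 dB [E|[i E]|[od E]].
- have [i iB] : exists i, i \in B by apply/set0Pn; rewrite -card_gt0; lia.
  by have /matrixP/(_ 0 i) := E; rewrite !mxE iB.
- suff /subset_leq_card : B \subset [set i] by rewrite cards1; lia.
  apply/subsetP => j jB; rewrite inE; have /matrixP/(_ 0 j) := E.
  by rewrite !mxE jB eqxx /=; case: (j == i).
- case: dB => [/negP//|]; suff -> : B = setT by rewrite cardsT card_ord ltnn.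
  apply/setP => j; have /matrixP/(_ 0 j) := E.
  by rewrite !mxE inE; case: (_ \in _).
Qed.

(** * Lower bounds: points of weight 2, then parity *)

Lemma sum_norm_signed d n (v : 'rV[int]_n) :
  signed_vector d v -> \sum_i `|v 0 i| = d%:R.
Proof.
case=> v1 vd; rewrite -vd -sum1_card natr_sum big_mkcond [RHS]big_mkcond /=.
by apply: eq_bigr => i _; rewrite !inE; case: (v1 i) => ->.
Qed.

Lemma cover_lower d n (V : {fset 'rV[int]_n}) :
  (2 <= d <= n)%N -> orthogonal_cover d V ->
  (2 * (n * (n - 1)) <= #|` V|%fset * d ^ 2)%N.
Proof.
move=> /andP[d2 dn] [VS VC].
pose q (v : 'rV[int]_n) i j : int := `|v 0 i| * `|v 0 j| - v 0 i * v 0 j.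
have q0 v i j : 0 <= q v i j by rewrite /q -normrM subr_ge0 ler_norm.
have up v : v \in V -> \sum_i \sum_j q v i j <= (d ^ 2)%:R.
  move=> /VS /sum_norm_signed vd.
  have -> : \sum_i \sum_j q v i j = (d%:R) ^+ 2 - (\sum_i v 0 i) ^+ 2.
    rewrite -vd !expr2 !mulr_suml -sumrB; apply: eq_bigr => i _.
    by rewrite !mulr_sumr -sumrB.
  by rewrite natrX lerBlDr lerDl sqr_ge0.
have low i j : i != j -> 2 <= \sum_(v <- V) q v i j.
  move=> ij; have cB : #|[set i; j]| = 2%N by rewrite cards2 ij.
  have [||v vV [v0 vnt]] := VC (indicator [set i; j]).
  - exact: cube_indicator.
  - apply: nontrivial_indicator; rewrite cB //.
    (* For n = 2 the pair is the all-ones point, which is non-trivial because d = 2 is even. *)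
    by case: (ltnP 2 n) => ?; [right | left; have -> : d = 2%N by lia].
  rewrite (perm_big _ (perm_to_rem vV)) big_cons /=.
  rewrite -[2]addr0 lerD //; last by apply: sumr_ge0.
  move: v0; rewrite inner_indicator big_setU1 ?inE //= big_set1 => v0.
  have [v1 _] := VS v vV.
  have : v 0 i != 0.
    apply/eqP => vi; apply: vnt => k; rewrite !mxE !inE.
    case: eqP => [->|_]; first by left.
    case: eqP => [->|_]; last by right.
    by left; move: v0; rewrite vi add0r.
  rewrite /q; have -> : v 0 j = - v 0 i by apply/eqP; rewrite -addr_eq0 addrC v0.
  by case: (v1 i) => ->.
have : \sum_(i < n) \sum_(j < n | j != i) (2 : int) <= \sum_(v <- V) (d ^ 2)%:R.
  apply: (@le_trans _ _ (\sum_(v <- V) \sum_i \sum_j q v i j)).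
    rewrite [X in _ <= X]exchange_big; apply: ler_sum => i _.
    rewrite [X in _ <= X]exchange_big [X in _ <= X](bigD1 i) //=.
    rewrite -[X in X <= _]add0r; apply: lerD.
      by apply: sumr_ge0 => v _; apply: q0.
    by apply: ler_sum => j ji; apply: low; rewrite eq_sym.
  by rewrite big_seq [X in _ <= X]big_seq; apply: ler_sum => v /up.
rewrite big_const_seq count_predT iter_addr addr0.
under eq_bigr => i _.
  rewrite sumr_const (eq_card (B := predC1 i)); last by [].
  rewrite cardC1 card_ord.
  over.
rewrite sumr_const card_ord.
by lia.
Qed.


Lemma F2_eq1 (x : 'F_2) : x != 0 -> x = 1.
Proof. by case: x => [[|[|k]]] // *; apply/val_inj. Qed.

Lemma F2_natr (k : nat) : k%:R = (odd k)%:R :> 'F_2.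
Proof.
rewrite -{1}(odd_double_half k) -mul2n natrD natrM.
have -> : 2%:R = 0 :> 'F_2 by apply/val_inj.
by rewrite mul0r addr0.
Qed.

(** Signs vanish modulo 2, so only the number of non-zero entries counts. *)
Lemma F2_sum_signed d n (v : 'rV[int]_n) : signed_vector d v ->
  \sum_i (v 0 i)%:~R = (odd d)%:R :> 'F_2.
Proof.
move=> vd; rewrite -F2_natr -[RHS](rmorph_nat (intmul 1)).
rewrite -(sum_norm_signed vd) rmorph_sum; apply: eq_bigr => i _ /=.
by case: (vd.1 i) => -> //; apply/val_inj.
Qed.

(* The column [delta_mx i 0] added to M forces a kernel vector to vanish at i. If
   the kernel vectors vanishing at 0 and at 1 have no other zero, their sum has
   at least two zeros since n > 3. *)
Lemma cover_lower_odd d n (V : {fset 'rV[int]_n}) :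
  (3 < n)%N -> odd d -> orthogonal_cover d V -> (n - 1 <= #|` V|%fset)%N.
Proof.
move=> n3 od [VS VC]; rewrite leqNgt; apply/negP => Vn.
pose M : 'M['F_2]_(n, #|` V|%fset) :=
  \matrix_(i, k) ((V : seq _)`_k 0 i)%:~R.
have K i : exists x : 'rV_n, [/\ x != 0, x *m M = 0 & x 0 i = 0].
  pose Mi := row_mx M (delta_mx i 0 : 'cV_n).
  (* [Mi] has n rows and at most n - 1 columns. *)
  have : kermx Mi != 0.
    rewrite kermx_eq0 /row_free; have := rank_leq_col Mi; lia.
  case/rowV0Pn => x /sub_kermxP; rewrite mul_mx_row -row_mx0 => /eq_row_mx[xM xi] x0.
  exists x; split=> //; have /matrixP/(_ 0 0) := xi; rewrite !mxE => <-.
  rewrite (bigD1 i) //= big1 ?mxE ?eqxx ?mulr1 ?addr0 // => j ji.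
  by rewrite mxE (negbTE ji) mulr0.
have [x [x0 xM [p [q [pq xp xq]]]]] : exists x : 'rV['F_2]_n,
    [/\ x != 0, x *m M = 0 & exists p q, [/\ p != q, x 0 p = 0 & x 0 q = 0]].
  have n0 : (0 < n)%N by lia.
  have n1 : (1 < n)%N by lia.
  have n2 : (2 < n)%N by lia.
  have [x [x0 xM xi]] := K (Ordinal n0).
  have [y [y0 yM yi]] := K (Ordinal n1).
  case: (pickP (fun p => (p != Ordinal n0) && (x 0 p == 0))) => [p /andP[pi /eqP xp]|xn].
    by exists x; split=> //; exists p, (Ordinal n0).
  case: (pickP (fun p => (p != Ordinal n1) && (y 0 p == 0))) => [p /andP[pi /eqP yp]|yn].
    by exists y; split=> //; exists p, (Ordinal n1).
  have x1 p : p != Ordinal n0 -> x 0 p = 1.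
    by move=> pi; apply: F2_eq1; have := xn p; rewrite pi /= => ->.
  have y1 p : p != Ordinal n1 -> y 0 p = 1.
    by move=> pi; apply: F2_eq1; have := yn p; rewrite pi /= => ->.
  exists (x + y); split.
  - apply/eqP => /matrixP/(_ 0 (Ordinal n0)).
    by rewrite !mxE xi y1.
  - by rewrite mulmxDl xM yM addr0.
  - exists (Ordinal n2), (Ordinal n3).
    by split=> //; rewrite !mxE x1 ?y1 //; apply/val_inj.
(* This is the point 1 + x: the two zeros of x give it two elements, and x being non-zero keeps it
   from being full. *)
pose B := [set i | x 0 i == 0].
have [||v vV [+ _]] := VC (indicator B).
- exact: cube_indicator.
- apply: nontrivial_indicator.
    have /subset_leq_card : [set p; q] \subset B.
      by apply/subsetP => i; rewrite !inE => /orP[]/eqP->; apply/eqP.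
    by rewrite cards2 pq.
  right; rewrite -[n in (_ < n)%N]card_ord -cardsT proper_card // properT.
  apply: contra x0 => /eqP BT; apply/eqP/rowP => i; rewrite mxE.
  by have /setP/(_ i) := BT; rewrite !inE => /eqP.
rewrite inner_indicator => /(congr1 (intmul (1 : 'F_2))).
rewrite rmorph_sum /= rmorph0 => vB.
(* The part of the sum on B vanishes by orthogonality; the part off B is the product of v with x, an
   entry of [x *m M]. *)
have : \sum_i (v 0 i)%:~R = 0 :> 'F_2.
  rewrite (bigID (mem B)) /= vB add0r.
  have iV : (index v V < #|` V|%fset)%N by rewrite index_mem.
  have /matrixP/(_ 0 (Ordinal iV)) := xM; rewrite !mxE => E; rewrite -[RHS]E.
  rewrite big_mkcond; apply: eq_bigr => i _; rewrite !mxE nth_index // inE.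
  by case: eqP => [->|/eqP/F2_eq1 ->]; rewrite ?mul0r ?mul1r.
by rewrite (F2_sum_signed (VS v vV)) od.
Qed.

(** * Signed vectors with prescribed support, and rotations on a window *)

Lemma nontrivial_pointP d n (A : 'rV[int]_n) :
  cube_point A -> ~ trivial_point d A ->
  exists2 B : {set 'I_n}, A = indicator B &
    (2 <= #|B|)%N /\ (~~ odd d \/ B != setT).
Proof.
move=> A01 AN; exists [set i | A 0 i == 1]; set B := [set _ | _].
  by apply/rowP => i; rewrite !mxE inE; case: (A01 i) => ->.
have AE : A = indicator B by apply/rowP => i; rewrite !mxE inE; case: (A01 i) => ->.
split.
- rewrite leqNgt; apply/negP => B1; apply: AN.
  have [B0|[i iB]] := set_0Vmem B.
    by apply: Or31; rewrite AE B0; apply/rowP => i; rewrite !mxE inE.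
  have /cards1P[j Bj] : #|B| == 1%N.
    by rewrite eqn_leq -ltnS B1 card_gt0; apply/set0Pn; exists i.
  apply: Or32; exists j; rewrite AE Bj; apply/rowP => k.
  by rewrite !mxE inE eqxx.
- case: (boolP (odd d)) => od; [right | by left].
  apply/eqP => BT; apply: AN; apply: Or33; split=> //.
  by rewrite AE BT; apply/rowP => k; rewrite !mxE inE.
Qed.

(** For injective [W] each sum has at most one term; summing over fibres avoids choosing a
    preimage. *)
Definition signed_embed n (J : finType) (W : J -> 'I_n) (e : J -> bool) : 'rV[int]_n :=
  \row_x \sum_(j | W j == x) (-1) ^+ e j.

Lemma signed_embedE n (J : finType) (W : J -> 'I_n) e j : injective W ->
  signed_embed W e 0 (W j) = (-1) ^+ e j.
Proof.
move=> Wi; rewrite mxE (bigD1 j) //= big1 ?addr0 // => k /andP[/eqP/Wi ->].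
by rewrite eqxx.
Qed.

Lemma signed_embed_out n (J : finType) (W : J -> 'I_n) e x :
  x \notin codom W -> signed_embed W e 0 x = 0.
Proof.
move=> xW; rewrite mxE big1 // => j /eqP Wj.
by rewrite -Wj codom_f in xW.
Qed.

Lemma signed_embed_vector n (J : finType) (W : J -> 'I_n) e : injective W ->
  signed_vector #|J| (signed_embed W e).
Proof.
move=> Wi; split=> [i|].
  case: (boolP (i \in codom W)) => [/codomP[j ->]|/signed_embed_out ->].
    by rewrite signed_embedE //; case: (e j); [apply: Or31 | apply: Or33].
  exact: Or32.
rewrite -(card_codom Wi); apply: eq_card => i; rewrite inE.
case: (boolP (i \in codom W)) => [/codomP[j ->]|/signed_embed_out ->].
  by rewrite signed_embedE // signr_eq0.
by rewrite eqxx.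
Qed.

Lemma inner_signed_embed n (J : finType) (W : J -> 'I_n) e (A : 'rV[int]_n) :
  inner (signed_embed W e) A = \sum_j (-1) ^+ e j * A 0 (W j).
Proof.
rewrite (partition_big W xpredT) //=; apply: eq_bigr => i _.
by rewrite mxE mulr_suml; apply: eq_bigr => j /eqP ->.
Qed.

(* The zero is at position i of the cycle; the negative entries are the other
   positions of the arc of length [uphalf d.+1] starting at i. *)
Definition window_vector n d (W : nat -> 'I_n) (i : nat) : 'rV[int]_n :=
  signed_embed (fun j : 'I_d => W ((i + j.+1) %% d.+1)%N)
               (fun j => (j < (uphalf d.+1).-1)%N).

Lemma window_inj n d (W : nat -> 'I_n) i :
  {in gtn d.+1 &, injective W} ->
  injective (fun j : 'I_d => W ((i + j.+1) %% d.+1)%N).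
Proof.
move=> Wi j k /Wi; rewrite !inE !ltn_mod => /(_ isT isT) /eqP.
rewrite eqn_modDl !modn_small ?ltnS ?ltn_ord // eqSS => /eqP.
exact: val_inj.
Qed.

Lemma window_vector_signed n d (W : nat -> 'I_n) i :
  {in gtn d.+1 &, injective W} -> signed_vector d (window_vector d W i).
Proof.
by move=> /(@window_inj _ _ _ i) /signed_embed_vector; rewrite card_ord; apply.
Qed.

(** The window is read as a cyclic word of length d + 1. At the position i given by
    [cyclic_halving], the negative entries meet exactly half of the ones lying off i. *)
Lemma window_vector_halving n d (W : nat -> 'I_n) (B : {set 'I_n}) :
  {in gtn d.+1 &, injective W} ->
  let w := (\sum_(k < d.+1) (W k \in B))%N in
  (2 <= w)%N -> (w < d.+1)%N \/ ~~ odd d ->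
  exists2 i, (i < d.+1)%N &
    nontrivially_orthogonal (window_vector d W i) (indicator B).
Proof.
move=> Wi w w2 wd.
pose a k := W (k %% d.+1)%N \in B.
have aN k : a (k + d.+1)%N = a k by rewrite /a modnDr.
have wE : arc a d.+1 0 = w.
  by apply: eq_bigr => k _; rewrite /a add0n modn_small.
have [||i iN iE] := cyclic_halving aN; rewrite ?wE //.
exists i => //.
set c' := (uphalf d.+1).-1.
have cE : uphalf d.+1 = c'.+1 by rewrite /c'.
have cd : (c' <= d)%N by rewrite /c'; lia.
have wE2 : w = (a i + \sum_(j < d) a (i + j.+1))%N.
  by rewrite -wE -(arc_full i aN) /arc big_ord_recl addn0.
rewrite cE wE /arc big_ord_recl addn0 in iE.
have {}iE : (2 * \sum_(j < c') a (i + j.+1) = \sum_(j < d) a (i + j.+1))%N.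
  apply/eqP; rewrite -(eqn_add2l (2 * a i)) -mulnDr iE wE2.
  by rewrite mul2n -addnn addnAC.
split.
  rewrite inner_signed_embed -/c'.
  (* Each sign is 1 minus twice the indicator of the negative half. *)
  transitivity (\sum_(j < d) (a (i + j.+1))%:R
     - \sum_(j < d) (2 * (j < c') * a (i + j.+1))%:R : int).
    rewrite -sumrB; apply: eq_bigr => j _; rewrite mxE /a.
    by case: (j < c')%N; case: (_ \in B).
  rewrite -!natr_sum -iE big_distrr /=; apply/eqP; rewrite subr_eq0; apply/eqP.
  congr (_%:R); rewrite (big_ord_widen _ (fun j => 2 * a (i + j.+1))%N cd) big_mkcond /=.
  by apply: eq_bigr => j _; case: (j < c')%N; rewrite ?muln1 ?muln0.
(* Trivial orthogonality would leave no one off position i, whereas w is at least 2. *)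
move=> T; suff : (\sum_(j < d) a (i + j.+1) = 0)%N by case: (a i) wE2 => /=; lia.
apply: big1 => j _; have := T (W ((i + j.+1) %% d.+1)%N).
rewrite (signed_embedE (W := fun j : 'I_d => W ((i + j.+1) %% d.+1)%N)); last exact: window_inj.
rewrite mxE /a; case: (_ \in B) => // -[/eqP|//].
by rewrite signr_eq0.
Qed.

(** * Selection lemmas, then windows and blocks of coordinates *)

Lemma set_between (T : finType) (P Q : {set T}) d :
  P \subset Q -> (#|P| <= d <= #|Q|)%N ->
  exists S : {set T}, [/\ P \subset S, S \subset Q & #|S| = d].
Proof.
move=> PQ; elim: d => [|d IH] /andP[Pd dQ].
  by exists P; split=> //; lia.
case: (ltngtP #|P| d.+1) Pd => // [Pd|Pd] _; last by exists P.
have [|S [PS SQ Sd]] := IH; first by lia.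
have /set0Pn[z] : Q :\: S != set0.
  by rewrite -card_gt0 cardsD (setIidPr SQ); lia.
rewrite inE => /andP[zS zQ]; exists (z |: S); split.
- exact: subset_trans PS (subsetUr _ _).
- by rewrite subUset sub1set zQ.
- by rewrite cardsU1 zS Sd.
Qed.

(** Finite choice by induction on the list; it turns [pair_vector] into a list of vectors of known
    length. *)
Lemma seq_witnesses (T U : eqType) (R : T -> U -> Prop) (s : seq T) :
  (forall p, exists v, R p v) ->
  exists vs : seq U, [/\ size vs = size s, (forall v, v \in vs -> exists p, R p v)
    & forall p, p \in s -> exists2 v, v \in vs & R p v].
Proof.
move=> H; elim: s => [|p s [vs [sz vsR sR]]]; first by exists [::].
have [v Rv] := H p; exists (v :: vs); split=> [/=|u|q].
- by rewrite sz.
- by rewrite inE => /orP[/eqP ->|/vsR //]; exists p.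
- rewrite inE => /orP[/eqP ->|/sR [u uvs Ru]]; first by exists v; rewrite ?mem_head.
  by exists u; rewrite // inE uvs orbT.
Qed.

(* The offset is truncated so that the last window still fits in 'I_n.+1; it may
   then overlap the previous one. *)
Definition window (n d q k : nat) : 'I_n.+1 :=
  inord (if k < 2 then k else k + minn (q * d.-1) (n - d))%N.

(** The dimension is [n.+1]: here [n] is the n - 1 of the stated bounds. *)
Definition window_set n d q : {set 'I_n.+1} := [set window n d q k | k : 'I_d.+1].

Lemma window_val n d q k : (d <= n)%N -> (2 <= d)%N -> (k <= d)%N ->
  window n d q k = (if k < 2 then k else k + minn (q * d.-1) (n - d))%N :> nat.
Proof. by move=> dn d2 kd; rewrite inordK //; case: ifP => _; lia. Qed.

Lemma window_injective n d q : (d <= n)%N -> (2 <= d)%N ->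
  {in gtn d.+1 &, injective (window n d q)}.
Proof.
move=> dn d2 j k; rewrite !inE !ltnS => jd kd /(congr1 val) /=.
by rewrite !window_val //; case: ifP; case: ifP; lia.
Qed.

Lemma window_ord_inj n d q : (d <= n)%N -> (2 <= d)%N ->
  injective (fun k : 'I_d.+1 => window n d q k).
Proof.
move=> dn d2 j k E; apply: val_inj.
by apply: (window_injective dn d2) E; rewrite inE ltn_ord.
Qed.

Lemma card_window_set n d q : (d <= n)%N -> (2 <= d)%N -> #|window_set n d q| = d.+1.
Proof.
by move=> dn d2; rewrite card_imset ?card_ord //; apply: window_ord_inj.
Qed.

Lemma window_count n d q (B : {set 'I_n.+1}) : (d <= n)%N -> (2 <= d)%N ->
  (\sum_(k < d.+1) (window n d q k \in B))%N = #|B :&: window_set n d q|.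
Proof.
move=> dn d2; rewrite -sum1_card.
rewrite (eq_bigl (fun x => (x \in window_set n d q) && (x \in B))); last first.
  by move=> x; rewrite inE andbC.
rewrite big_mkcondr big_imset /=; last first.
  by move=> j k _ _; apply: window_ord_inj.
by rewrite big_mkcond; apply: eq_bigr => k _; case: (_ \in B).
Qed.

Lemma low_in_window n d q (x : 'I_n.+1) : (d <= n)%N -> (2 <= d)%N ->
  (x < 2)%N -> x \in window_set n d q.
Proof.
move=> dn d2 x2; apply/imsetP.
have xd : (x < d.+1)%N by lia.
by exists (Ordinal xd) => //; apply: ord_inj; rewrite window_val //= x2.
Qed.

(** Past 0 and 1 the windows advance by d - 1, so the quotient locates x; truncation only shifts the
    window left, and x <= n keeps x inside. *)
Lemma mem_window_set n d (x : 'I_n.+1) : (d <= n)%N -> (2 <= d)%N ->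
  x \in window_set n d ((x - 2) %/ d.-1).
Proof.
move=> dn d2; have [x2|x2] := ltnP x 2; first exact: low_in_window.
apply/imsetP; set q := (_ %/ _)%N.
have E := divn_eq (x - 2) d.-1; rewrite -/q in E.
have L : ((x - 2) %% d.-1 < d.-1)%N by rewrite ltn_mod; lia.
have xn := ltn_ord x.
have kd : (x - minn (q * d.-1) (n - d) < d.+1)%N by lia.
exists (Ordinal kd) => //; apply: ord_inj; rewrite window_val //=.
by case: ifP; lia.
Qed.

(* Rounding in 2 (x - 2) / (d - 1) makes the blocks alternate between the two
   halves of [2 + q (d - 1), 2 + (q + 1) (d - 1)), even when d is even. *)
Definition block d (x : nat) : nat := ((2 * (x - 2)) %/ d.-1)%N.

Lemma block_half d x : (block d x %/ 2 = (x - 2) %/ d.-1)%N.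
Proof. by rewrite /block -divnMA mulnC divnMr. Qed.

(** In a block, 2 (x - 2) lies among d - 1 consecutive integers, at most [d./2] of which are even;
    [f] lists the candidates from the first one on. *)
Lemma card_block n d b : (2 <= d)%N ->
  (#|[set x : 'I_n.+1 | (2 <= x)%N && (block d x == b)]| <= d./2)%N.
Proof.
move=> d2; set m := (b * d.-1)%N.
pose f (k : 'I_(d./2)) : 'I_n.+1 := inord (2 + uphalf m + k).
rewrite -[leqRHS]card_ord; apply: leq_trans (leq_imset_card f _).
apply/subset_leq_card/subsetP => x; rewrite inE => /andP[x2 /eqP xb].
have E := divn_eq (2 * (x - 2)) d.-1; rewrite -/(block d x) xb -/m in E.
have L : ((2 * (x - 2)) %% d.-1 < d.-1)%N by rewrite ltn_mod; lia.
have kd : (x - (2 + uphalf m) < d./2)%N by lia.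
apply/imsetP; exists (Ordinal kd) => //; apply: ord_inj.
have mx : (2 + uphalf m <= x)%N by lia.
by rewrite inordK /= subnKC.
Qed.

(** The vector is chosen before B: positive on block b, negative on the rest of a support of size d
    that contains both blocks and stays in their windows. *)
Lemma pair_vector n d b b' : (d <= n)%N -> (2 <= d)%N ->
  exists v : 'rV[int]_n.+1, signed_vector d v /\
  forall (B : {set 'I_n.+1}) (x y : 'I_n.+1),
    x \in B -> y \in B -> (2 <= x)%N -> (2 <= y)%N ->
    block d x = b -> block d y = b' -> b != b' ->
    (#|B :&: window_set n d (b %/ 2)| <= 1)%N ->
    (#|B :&: window_set n d (b' %/ 2)| <= 1)%N ->
    nontrivially_orthogonal v (indicator B).
Proof.
move=> dn d2.
pose blk b := [set x : 'I_n.+1 | (2 <= x)%N && (block d x == b)].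
have blkW c : blk c \subset window_set n d (c %/ 2).
  apply/subsetP => x; rewrite inE => /andP[x2 /eqP <-].
  by rewrite block_half mem_window_set.
have [||S [PS SQ Sd]] := @set_between _ (blk b :|: blk b')
    (window_set n d (b %/ 2) :|: window_set n d (b' %/ 2)) d.
- exact: setUSS.
- apply/andP; split.
    have := card_block n b d2; have := card_block n b' d2.
    by have := cardsU (blk b) (blk b'); rewrite -/(blk b) -/(blk b'); lia.
  by rewrite ltnW // -(card_window_set (b %/ 2) dn d2) subset_leq_card ?subsetUl.
pose v := signed_embed (fun j : {x | x \in S} => val j)
                       (fun j => block d (val j) != b).
have vS z : z \in S -> v 0 z = (-1) ^+ (block d z != b).
  by move=> zS; rewrite -[z]/(val (exist (fun z => z \in S) z zS)) signed_embedE //; apply: val_inj.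
exists v; split.
  by rewrite -Sd -card_sig; apply: signed_embed_vector; apply: val_inj.
move=> B x y xB yB x2 y2 xb yb bb' /card_le1_eqP Wb /card_le1_eqP Wb'.
have xblk : x \in blk b by rewrite inE x2 xb eqxx.
have yblk : y \in blk b' by rewrite inE y2 yb eqxx.
have xS : x \in S by rewrite (subsetP PS) // inE xblk.
have yS : y \in S by rewrite (subsetP PS) // inE yblk orbT.
have vx : v 0 x = 1 by rewrite vS // xb eqxx.
have xy : y != x by apply: contra bb' => /eqP E; rewrite -xb -yb E.
split; last by move=> /(_ x); rewrite vx mxE xB; case.
rewrite inner_indicator (bigD1 x) //= (bigD1 y) ?yB //= big1 => [|z].
  by rewrite vx vS // yb eq_sym bb'.
move=> /andP[/andP[zB zx] zy]; apply: signed_embed_out; apply/codomP => -[[z' zS] /= zz'].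
(* A further one of B in the support would share a window with x or with y. *)
subst z'; have := subsetP SQ z zS; rewrite inE => /orP[zW|zW].
- by case/eqP: zx; apply: Wb; rewrite inE ?zB ?xB //= (subsetP (blkW _)).
- by case/eqP: zy; apply: Wb'; rewrite inE ?zB ?yB //= (subsetP (blkW _)).
Qed.

(** * The covers for the upper bound *)

Lemma ordered_pairs_size k :
  size [seq (i, j) | j <- iota 0 k, i <- iota 0 j] = 'C(k, 2).
Proof.
rewrite size_allpairs_dep sumnE big_map -bin2_sum /index_iota subn0.
by apply: eq_bigr => j _; rewrite size_iota.
Qed.

Lemma cover_upper d n : (2 <= d)%N -> (d <= n)%N ->
  exists2 V : {fset 'rV[int]_n.+1}, orthogonal_cover d V &
    (#|` V|%fset <= 'C(ceil_div (2 * n) d.-1, 2) + ceil_div n d.-1 * d.+1)%N.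
Proof.
(* [k] bounds the number of blocks and [t] the number of windows. *)
move=> d2 dn; set k := ceil_div (2 * n) _; set t := ceil_div n _.
have kP : (2 * n <= k * d.-1)%N by apply: ceil_div_mul; lia.
have tP : (n <= t * d.-1)%N by apply: ceil_div_mul; lia.
have [ps [sps psR Rps]] := seq_witnesses
  [seq (i, j) | j <- iota 0 k, i <- iota 0 j]
  (fun p : nat * nat => @pair_vector n d p.1 p.2 dn d2).
pose ws := [seq window_vector d (window n d q) i | q <- iota 0 t, i <- iota 0 d.+1].
exists [fset v in ps ++ ws]%fset; last first.
  rewrite card_fseq; apply: leq_trans (size_undup _) _.
  by rewrite size_cat sps ordered_pairs_size size_allpairs !size_iota.
split=> [v|A A01 AN].
  rewrite in_fset /= mem_cat => /orP[/psR [p [] //]|/allpairsP[[q i] [_ _ ->]]].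
  exact/window_vector_signed/window_injective.
have [B -> [B2 dB]] := nontrivial_pointP A01 AN.
suff [v vV vB] : exists2 v, v \in ps ++ ws & nontrivially_orthogonal v (indicator B).
  by exists v; rewrite // in_fset.
apply: NNPP => H.
have W q : (q < t)%N -> (2 <= #|B :&: window_set n d q|)%N ->
    odd d /\ window_set n d q \subset B.
  move=> qt; rewrite -window_count // => w2.
  suff : ~ ((\sum_(j < d.+1) (window n d q j \in B) < d.+1)%N \/ ~~ odd d).
    move=> /not_or_and[wN /negP]; rewrite negbK => od; split=> //.
    apply/setIidPr/eqP; rewrite eqEcard subsetIr /= card_window_set //.
    by rewrite -window_count //; lia.
  move=> wd; apply: H.
  have [i iN iB] := window_vector_halving (window_injective dn d2) w2 wd.
  exists (window_vector d (window n d q) i) => //.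
  by rewrite mem_cat; apply/orP/or_intror/allpairs_f; rewrite mem_iota.
have inW (x : 'I_n.+1) : ((x - 2) %/ d.-1 < t)%N.
  by rewrite ltn_divLR; have := ltn_ord x; lia.
have [[q qt q2]|nW] := classic (exists2 q, (q < t)%N & (2 <= #|B :&: window_set n d q|)%N).
  have [od sub] := W q qt q2.
  have low (x : 'I_n.+1) : (x < 2)%N -> x \in B.
    by move=> x2; apply: (subsetP sub); apply: low_in_window.
  have BT : B = setT.
    apply/setP => x; rewrite inE.
    have [_ subx] : odd d /\ window_set n d ((x - 2) %/ d.-1) \subset B.
      apply: W => //.
      have n1 : (1 < n.+1)%N by lia.
      have /subset_leq_card : [set ord0; Ordinal n1] \subset B :&: window_set n d ((x - 2) %/ d.-1).
        by apply/subsetP => y; rewrite !inE => /orP[]/eqP->; rewrite low // low_in_window.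
      by rewrite cards2.
    by apply: (subsetP subx); apply: mem_window_set.
  by case: dB; rewrite ?od // BT eqxx.
have le1 q : (q < t)%N -> (#|B :&: window_set n d q| <= 1)%N.
  by move=> qt; rewrite leqNgt; apply/negP => ?; apply: nW; exists q.
have /card_gt1P[x [y [xB yB xy]]] := B2.
(* A coordinate below 2 lies in every window, in particular in one that contains [z']. *)
have big z z' : z \in B -> z' \in B -> z != z' -> (2 <= z)%N.
  move=> zB zB' zz; rewrite leqNgt; apply/negP => z2.
  have /card_le1_eqP E := le1 _ (inW z').
  case/eqP: zz; apply: E; rewrite inE ?zB ?zB' /= ?mem_window_set //.
  exact: low_in_window.
have {}bl : exists x y : 'I_n.+1, [/\ x \in B, y \in B, (2 <= x)%N, (2 <= y)%N &
    (block d x < block d y)%N].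
  have x2 := big x y xB yB xy; have y2 := big y x yB xB; rewrite eq_sym in y2.
  case: (ltngtP (block d x) (block d y)) => [lt|lt|E].
  - by exists x, y; split=> //; apply: y2.
  - by exists y, x; split=> //; apply: y2.
  have /card_le1_eqP U := le1 _ (inW x).
  case/eqP: xy; apply: U; rewrite inE ?xB ?yB /= ?mem_window_set //.
  by rewrite -block_half E block_half mem_window_set.
have {x y xB yB xy} [x [y [xB yB x2 y2 lt]]] := bl.
have yk : (block d y < k)%N by rewrite /block ltn_divLR; have := ltn_ord y; lia.
have [|v vps [_ vB]] := Rps (block d x, block d y).
  by apply/allpairsPdep; exists (block d y), (block d x); rewrite !mem_iota.
apply: H; exists v; first by rewrite mem_cat vps.
by apply: (vB B x y) => //; rewrite ?block_half ?le1 // neq_ltn lt.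
Qed.

(** For d = n <= 3 the non-trivial points have weight 2, and [u x], positive only at x, is
    orthogonal to every pair containing x. *)
Lemma cover_full n : (2 <= n <= 3)%N ->
  exists2 V : {fset 'rV[int]_n}, orthogonal_cover n V & (#|` V|%fset <= n)%N.
Proof.
move=> n23; pose u (i : 'I_n) := signed_embed id (fun j : 'I_n => j != i).
have uE i j : u i 0 j = (-1) ^+ (j != i) by apply: (signed_embedE (W := id)).
exists [fset v in [seq u i | i <- enum 'I_n]]%fset; last first.
  rewrite card_fseq; apply: leq_trans (size_undup _) _.
  by rewrite size_map -cardE card_ord.
split=> [v|A A01 AN].
  rewrite in_fset => /mapP[i _ ->]; rewrite -[X in signed_vector X _]card_ord.
  exact: signed_embed_vector.
have [B -> [B2 dB]] := nontrivial_pointP A01 AN.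
have /cards2P[x [y [xy BE]]] : #|B| == 2%N.
  rewrite eqn_leq B2 andbT; case: dB => [en|/negP BT].
    by have := max_card (mem B); rewrite card_ord; case: n {u uE A A01 AN} B B2 n23 en => [|[|[|[|]]]].
  have : (#|B| < n)%N by rewrite -[n in (_ < n)%N]card_ord -cardsT proper_card // properT; apply/negP.
  by lia.
exists (u x); first by rewrite in_fset /= map_f // mem_enum.
split; last by move=> /(_ x); rewrite uE !mxE BE !inE eqxx; case.
rewrite inner_indicator BE big_setU1 ?inE //= big_set1 !uE eqxx.
by rewrite eq_sym xy.
Qed.

Lemma cover_exists d n : (2 <= d)%N -> (d <= n)%N -> (d < n)%N || (n <= 3)%N ->
  exists2 V : {fset 'rV[int]_n}, orthogonal_cover d V &
    (#|` V|%fset <= 'C(ceil_div (2 * (n - 1)) (d - 1), 2)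
              + ceil_div (n - 1) (d - 1) * (d + 1))%N.
Proof.
move=> d2; rewrite leq_eqVlt => /orP[/eqP <-{n}|].
  rewrite ltnn /= => d3; have [|V VC Vd] := @cover_full d; first by rewrite d2.
  exists V => //; apply: leq_trans Vd _; rewrite addnC; apply: leq_trans (leq_addr _ _).
  (* The ceiling is at least 1, so the second term of the bound alone exceeds d. *)
  have : (d - 1 <= ceil_div (d - 1) (d - 1) * (d - 1))%N by apply: ceil_div_mul; lia.
  by case: (ceil_div _ _) => [|c]; lia.
case: n => // n dn _; rewrite !subn1 addn1 /=; exact: cover_upper.
Qed.

(** * Existence of the minimum, and the theorem *)

Lemma beta_exists d n (V : {fset 'rV[int]_n}) :
  orthogonal_cover d V -> exists b, is_beta d n b.
Proof.
have [m] := ubnP #|` V|%fset; elim: m V => // m IH V Vm VC.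
case: (classic (exists2 U : {fset 'rV[int]_n}, orthogonal_cover d U &
    (#|` U| < #|` V|)%fset%N)) => [[U UC UV]|nU].
  by apply: IH UC; apply: leq_trans UV _.
exists #|` V|%fset; split; first by exists V.
by move=> U UC; rewrite leqNgt; apply/negP => ?; apply: nU; exists U.
Qed.

Theorem theorem1 (d n : nat) (hd : (2 <= d)%N) (hdn : (d <= n)%N) :
  ((d < n)%N || (n <= 3)%N -> exists b : nat, is_beta d n b) /\
  (forall b : nat, is_beta d n b ->
    [/\ 2 * n%:R * (n%:R - 1) / d%:R ^+ 2 <= b%:R :> rat,
        (b <= 'C(ceil_div (2 * (n - 1)) (d - 1), 2)
              + ceil_div (n - 1) (d - 1) * (d + 1))%N
      & odd d -> (n - 1 <= b)%N]).
Proof.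
split=> [dn|b bP].
  by have [V VC _] := cover_exists hd hdn dn; apply: beta_exists VC.
have [[V VC Vb] bmin] := bP.
have low : (2 * (n * (n - 1)) <= b * d ^ 2)%N.
  by rewrite -Vb; apply: cover_lower VC; rewrite hd.
split.
- rewrite ler_pdivrMr; last by rewrite exprn_gt0 // ltr0n; lia.
  have -> : n%:R - 1 = (n - 1)%:R :> rat by rewrite natrB //; lia.
  by rewrite -natrX -!natrM ler_nat -mulnA.
- have dn : (d < n)%N || (n <= 3)%N.
    case: ltngtP hdn => //= dn _; rewrite leqNgt; apply/negP => n3.
    by apply: (no_beta_full n3 (b := b)); rewrite -{1}dn.
  have [U UC Ub] := cover_exists hd hdn dn.
  exact: leq_trans (bmin U UC) Ub.
- move=> od; have [n3|n3] := ltnP 3 n; first by rewrite -Vb; apply: cover_lower_odd VC.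
  (* In the remaining case d = n = 3, the quadratic bound reads 12 <= 9 b, hence b >= 2. *)
  have d3 : d = 3 by case: d hd hdn od {bP VC bmin low} => [|[|[|[|]]]] // *; lia.
  by move: low; rewrite d3; lia.
Qed.
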